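(* Let $\mathbb{K}$ be a field of characteristic zero and let $n \geqslant 2$. For any nonzero $\delta \in \mathrm{Vec}(\mathbb{A}^n)$ there exists $D \in \mathrm{Vec}^c(\mathbb{A}^n)$ such that the Lie algebra generated by $\delta$ and $D$ (inside $\mathrm{Vec}(\mathbb{A}^n)$) contains the whole algebra $\mathrm{Vec}^c(\mathbb{A}^n)$.
   Context: $\mathbb{A}^n$ is the $n$-dimensional affine space over $\mathbb{K}$ with coordinates $x_1,\ldots,x_n$. $\mathrm{Vec}(\mathbb{A}^n)$ is the Lie algebra of polynomial vector fields $f_1\partial_{x_1}+\ldots+f_n\partial_{x_n}$ with $f_1,\ldots,f_n\in\mathbb{K}[x_1,\ldots,x_n]$ (equivalently, all $\mathbb{K}$-derivations of $\mathbb{K}[x_1,\ldots,x_n]$), where $\partial_{x_i}$ is the partial derivative with respect to $x_i$, and the bracket is the commutator, i.e. $[f\partial_{x_i}, g\partial_{x_j}] = f\frac{\partial g}{\partial x_i}\partial_{x_j} - g\frac{\partial f}{\partial x_j}\partial_{x_i}$. The divergence is $\operatorname{div}(f_1\partial_{x_1}+\ldots+f_n\partial_{x_n}) = \frac{\partial f_1}{\partial x_1}+\ldots+\frac{\partial f_n}{\partial x_n}$. $\mathrm{Vec}^c(\mathbb{A}^n) = \{\delta\in \mathrm{Vec}(\mathbb{A}^n) \mid \operatorname{div}(\delta)\in\mathbb{K}\}$ is the Lie subalgebra of vector fields with constant divergence. The Lie algebra generated by a subset $S$ of a Lie algebra is the smallest Lie subalgebra ($\mathbb{K}$-subspace closed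 under the bracket) containing $S$. *)

(* Defs.v *)
From HB Require Import structures.
From mathcomp Require Import all_boot all_order all_algebra.
From mathcomp Require Export mpoly.

Set Implicit Arguments.
Unset Strict Implicit.
Unset Printing Implicit Defensive.

Import GRing.Theory.
Local Open Scope ring_scope.

(* A polynomial vector field f_1 d/dx_1 + ... + f_n d/dx_n is encoded by the
   family of its coefficients; as finite functions these form a K-vector space. *)
Notation vfield K n := {ffun 'I_n -> {mpoly K[n]}}.

Section VectorFields.
Variables (K : fieldType) (n : nat).
Implicit Types (u v w : vfield K n) (p q : {mpoly K[n]}).

Definition vf_apply u p : {mpoly K[n]} := \sum_(i < n) u i * mderiv i p.

(* Bilinear extension of
     [f d/dx_i, g d/dx_j] = f (dg/dx_i) d/dx_j - g (df/dx_j) d/dx_i;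
   vf_bracket_comm shows that it is the commutator of derivations. *)
Definition vf_bracket u v : vfield K n :=
  [ffun j => \sum_(i < n) (u i * mderiv i (v j) - v i * mderiv i (u j))].

Definition vf_div u : {mpoly K[n]} := \sum_(i < n) mderiv i (u i).

Definition const_div u : Prop := exists c : K, vf_div u = c%:MP.

Definition lie_subalgebra (L : vfield K n -> Prop) : Prop :=
  [/\ L 0,
      forall (a : K) u v, L u -> L v -> L (a *: u + v)
    & forall u v, L u -> L v -> L (vf_bracket u v)].

(* The intersection of all Lie subalgebras containing S. *)
Definition lie_generated (S : vfield K n -> Prop) u : Prop :=
  forall L, lie_subalgebra L -> (forall v, S v -> L v) -> L u.

Lemma lie_generated_sub (S : vfield K n -> Prop) u : S u -> lie_generated S u.
Proof. by move=> Su L _; apply. Qed.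

Lemma lie_generated_subalgebra (S : vfield K n -> Prop) :
  lie_subalgebra (lie_generated S).
Proof.
split=> [L [L0 _ _] _ //|a u v gu gv|u v gu gv] L LL SL.
  by have [_ LZ _] := LL; apply: LZ; [apply: gu | apply: gv].
by have [_ _ LB] := LL; apply: LB; [apply: gu | apply: gv].
Qed.

Lemma vf_bracket_comm u v p :
  vf_apply (vf_bracket u v) p
    = vf_apply u (vf_apply v p) - vf_apply v (vf_apply u p).
Proof.
have expand w1 w2 : vf_apply w1 (vf_apply w2 p)
    = \sum_(j < n) \sum_(i < n) w1 i * mderiv i (w2 j) * mderiv j p
      + \sum_(j < n) \sum_(i < n) w1 i * w2 j * mderiv i (mderiv j p).
  rewrite -big_split /=; under [RHS]eq_bigr do rewrite -big_split /=.
  rewrite [RHS]exchange_big /=; apply: eq_bigr => i _.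
  rewrite raddf_sum mulr_sumr; apply: eq_bigr => j _.
  by rewrite /= mderivM mulrDr !mulrA.
rewrite !expand.
have -> : \sum_(j < n) \sum_(i < n) v i * u j * mderiv i (mderiv j p)
        = \sum_(j < n) \sum_(i < n) u i * v j * mderiv i (mderiv j p).
  rewrite exchange_big; apply: eq_bigr => i _; apply: eq_bigr => j _.
  by rewrite mderiv_comm [v i * _]mulrC.
rewrite opprD addrACA subrr addr0 -sumrB; apply: eq_bigr => j _.
rewrite ffunE mulr_suml -sumrB; apply: eq_bigr => i _.
by rewrite mulrBl.
Qed.

End VectorFields.

(* Main.v *)
From HB Require Import structures.
Require Import Defs.
From mathcomp Require Import all_boot all_order all_algebra.
From mathcomp Require Import ring zify.

Set Implicit Arguments.
Unset Strict Implicit.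
Unset Printing Implicit Defensive.

Import GRing.Theory.
Local Open Scope ring_scope.

(** Write [d_i] for the partial derivative along the [i]-th coordinate.

    The field [D] is, up to a polynomial change of coordinates, a diagonal linear
    field [T = sum_i N ^ i x_i d_i]. The operator [ad T] is diagonal on the monomial
    fields [x^m d_i], so a Lie algebra that contains [T] and some field [v] contains
    every monomial component of [v] whose weight is not shared by another component
    ([lie_sub_component]). For [N] large, this applies to each monomial [x^m d_i] of
    [v] with [m i = 0] ([torus_separates]): its weight determines its multidegree
    [m - e_i], whose negative entry reveals [d_i].

    Automorphisms that preserve volume act on the fields of constant divergence and
    on Lie subalgebras, so [delta] may first be replaced by any of its transforms
    ([completable_push]). The elementary shears [x_i -> x_i + t x_k ^ e], [i != k],
    are enough to reach a field with many monomials ([completable_generic]). The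
    translations, [e = 0], make [delta] nonzero at the origin. With [e = d + 1] a
    nontrivial shear alters, among the coefficients of degree at most [d], only that of
    [x_k ^ d d_i], by a nonzero multiple of the constant coefficient along [d_k]
    ([mcoeff_push]). Using [d = 0] and then [d = 2], all the coefficients of [d_i] and
    of [x_k ^ 2 d_i], [i != k], become nonzero.

    It remains to see that [T], the [d_i] and the [x_k ^ 2 d_i] generate all fields of
    constant divergence. Fix an axis [o]. For [j != o] the fields
    [ham j f = (d_o f) d_j - (d_j f) d_o] bracket like their Hamiltonians
    [f] in the Poisson algebra of the plane of [x = x_o] and [y = x_j]
    ([ham_bracket]). From [x], [y], [x ^ 3] and [y ^ 3] one gets
    [{x ^ 3, y ^ 3} = 9 x ^ 2 y ^ 2], then [x ^ 2 y] and [x y ^ 2] by bracketing with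
    [x] and [y]. Bracketing with [x ^ 2 y] raises the exponent of
    [x ^ a]. Bracketing with the field of [x y ^ 2] multiplies the shears [q d_o], with
    [q] free of [x_o], by [x_j], whence all of them ([lie_sub_shear]). The bracket of
    [x ^ a] with a shear then gives every [ham j f] ([lie_sub_ham]), and by Poincare's
    lemma a divergence free field is a sum of these and a shear
    ([lie_sub_div_free]). Finally [T] itself has nonzero constant divergence. *)

(** * Derivations and changes of variables *)

Lemma mpoly_ring_ind (K : fieldType) (n : nat) (P : {mpoly K[n]} -> Prop) :
    (forall c, P c%:MP) -> (forall i, P 'X_i) ->
    (forall p q, P p -> P q -> P (p + q)) ->
    (forall p q, P p -> P q -> P (p * q)) ->
  forall p, P p.
Proof.
move=> PC PX PD PM.
have PXm m : P 'X_[m].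
  rewrite mpolyXE_id; apply: big_ind => // [|i _]; first by rewrite -mpolyC1.
  elim: (m i) => [|e IHe]; first by rewrite expr0 -mpolyC1.
  by rewrite exprS; apply: PM.
elim/mpolyind => [|c m p _ _ IHp]; first by rewrite -mpolyC0.
by apply: PD IHp; rewrite -mul_mpolyC; apply: PM.
Qed.

Lemma sumr_delta (V : zmodType) (n : nat) (k : 'I_n) (F : 'I_n -> V) :
  \sum_(j < n) F j *+ (j == k) = F k.
Proof.
rewrite (bigD1 k) //= eqxx mulr1n big1 ?addr0 // => j jk.
by rewrite (negPf jk).
Qed.

Section VectorFieldAlgebra.
Variables (K : fieldType) (n : nat).
Implicit Types (u v : vfield K n) (p q : {mpoly K[n]}).

Lemma mderivXU i j : mderiv i ('X_j : {mpoly K[n]}) = (j == i)%:R.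
Proof.
rewrite mderivX mnm1E; case: eqP => [->|_]; last by rewrite scale0r.
by rewrite scale1r -{1}[U_(i)%MM]add0m addmK mpolyX0.
Qed.

Lemma mderiv_XUexp (i j : 'I_n) e :
  mderiv i ('X_j ^+ e : {mpoly K[n]}) = ('X_j ^+ e.-1 *+ e) *+ (j == i).
Proof.
elim: e => [|e IHe]; first by rewrite expr0 -mpolyC1 mderivC mul0rn.
rewrite exprS mderivM mderivXU IHe.
case: (j == i); last by rewrite mul0r mulr0n mulr0 addr0.
rewrite mul1r !mulr1n /=; case: e {IHe} => [|e] /=; first by rewrite mulr0 addr0.
by rewrite mulrnAr -exprS -mulrS.
Qed.

Lemma vf_applyX u l : vf_apply u 'X_l = u l.
Proof.
rewrite /vf_apply (bigD1 l) //= big1 ?addr0 => [|j jl].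
  by rewrite mderivXU eqxx mulr1.
by rewrite mderivXU eq_sym (negPf jl) mulr0.
Qed.

Lemma vf_apply_is_linear u : linear (vf_apply u).
Proof.
move=> a p q; rewrite /vf_apply scaler_sumr -big_split /=.
by apply: eq_bigr => i _; rewrite mderivD mderivZ mulrDr -scalerAr.
Qed.

HB.instance Definition _ u :=
  GRing.isLinear.Build K {mpoly K[n]} {mpoly K[n]} _ (vf_apply u)
    (vf_apply_is_linear u).

Lemma vf_apply_combo a u v p :
  vf_apply (a *: u + v) p = a *: vf_apply u p + vf_apply v p.
Proof.
rewrite /vf_apply scaler_sumr -big_split /=.
by apply: eq_bigr => i _; rewrite !ffunE mulrDl scalerAl.
Qed.

(** A vector field is recovered from its action on the coordinates, so identities
    between vector fields can be checked on derivations. *)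
Lemma vf_apply_inj u v : (forall p, vf_apply u p = vf_apply v p) -> u = v.
Proof. by move=> uv; apply/ffunP => l; rewrite -!vf_applyX uv. Qed.

Lemma vf_bracketE u v l :
  vf_bracket u v l = vf_apply u (v l) - vf_apply v (u l).
Proof. by rewrite ffunE sumrB. Qed.

Lemma mderiv_comp (lq : n.-tuple {mpoly K[n]}) j p :
  mderiv j (p \mPo lq) = \sum_(l < n) (mderiv l p \mPo lq) * mderiv j (tnth lq l).
Proof.
elim/mpoly_ring_ind: p => [c|i|p q IHp IHq|p q IHp IHq].
- rewrite comp_mpolyC mderivC big1 // => l _.
  by rewrite mderivC comp_mpoly0 mul0r.
- rewrite comp_mpolyXU (bigD1 i) //= big1 ?addr0 => [|l li].
    by rewrite mderivXU eqxx comp_mpoly1 mul1r (tnth_nth 0).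
  by rewrite mderivXU eq_sym (negPf li) comp_mpoly0 mul0r.
- rewrite comp_mpolyD mderivD IHp IHq -big_split; apply: eq_bigr => l _.
  by rewrite mderivD comp_mpolyD mulrDl.
- rewrite rmorphM /= mderivM IHp IHq mulr_suml mulr_sumr -big_split.
  apply: eq_bigr => l _; rewrite mderivM comp_mpolyD !rmorphM /=; ring.
Qed.

End VectorFieldAlgebra.

Definition completable (K : fieldType) (n : nat) (u : vfield K n) : Prop :=
  exists D : vfield K n, const_div D /\
    (forall w, const_div w -> lie_generated (fun v => v = u \/ v = D) w).

Lemma mcoeff_XM_eq0 (K : fieldType) (n : nat) (a m : 'X_{1..n}) (p : {mpoly K[n]}) :
  (forall b, (a + b)%MM <> m) -> ('X_[a] * p)@_m = 0.
Proof.
move=> abm; rewrite {1}(mpolyE p) mulr_sumr raddf_sum big1 // => b _ /=.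
rewrite -scalerAr -mpolyXD mcoeffZ mcoeffX.
by case: eqP => [/abm //|_]; rewrite mulr0.
Qed.

(** * Elementary shears *)

Section Shear.
Variables (K : fieldType) (n : nat) (i k : 'I_n).
Implicit Types (u v : vfield K n) (p q : {mpoly K[n]}) (t : K) (e : nat).

Definition shear e t : n.-tuple {mpoly K[n]} :=
  [tuple 'X_l + (t *: 'X_k ^+ e) *+ (l == i) | l < n].

(** The image [sigma \o u \o sigma^-1] of the derivation [u] under the
    automorphism [sigma] that substitutes the shear, read off on coordinates. *)
Definition push e t u : vfield K n :=
  [ffun l => vf_apply u ('X_l \mPo shear e (- t)) \mPo shear e t].

Hypothesis ik : i != k.

Lemma shearX e t l : 'X_l \mPo shear e t = 'X_l + (t *: 'X_k ^+ e) *+ (l == i).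
Proof. by rewrite comp_mpolyXU -tnth_nth tnth_mktuple. Qed.

Lemma shearXk e t f : 'X_k ^+ f \mPo shear e t = 'X_k ^+ f.
Proof. by rewrite rmorphXn /= shearX eq_sym (negPf ik) addr0. Qed.

Lemma shearK e t p : (p \mPo shear e (- t)) \mPo shear e t = p.
Proof.
elim/mpoly_ring_ind: p => [c|l|p q IHp IHq|p q IHp IHq].
- by rewrite !comp_mpolyC.
- rewrite shearX comp_mpolyD shearX comp_mpolyMn comp_mpolyZ shearXk.
  by rewrite -addrA -mulrnDl scaleNr subrr mul0rn addr0.
- by rewrite !comp_mpolyD IHp IHq.
- by rewrite !rmorphM /= IHp IHq.
Qed.

Lemma shearVK e t p : (p \mPo shear e t) \mPo shear e (- t) = p.
Proof. by have := shearK e (- t) p; rewrite opprK. Qed.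

Lemma mderiv_shear e t j p :
  mderiv j (p \mPo shear e t)
    = (mderiv j p \mPo shear e t)
      + ((t *: 'X_k ^+ e.-1 *+ e) * (mderiv i p \mPo shear e t)) *+ (j == k).
Proof.
rewrite mderiv_comp.
under eq_bigr => l _ do rewrite tnth_mktuple mderivD mulrDr mderivMn mderivZ
  mderivXU mderiv_XUexp.
rewrite big_split /=; congr (_ + _).
  rewrite (bigD1 j) //= big1 ?addr0 => [|l lj]; first by rewrite eqxx mulr1.
  by rewrite (negPf lj) mulr0.
rewrite (bigD1 i) //= big1 ?addr0 => [|l li]; last first.
  by rewrite (negPf li) mulr0n mulr0.
rewrite eqxx mulr1n [k == j]eq_sym; case: (j == k); last by rewrite !mulr0n scaler0 mulr0.
by rewrite !mulr1n mulrC scalerMnr.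
Qed.

Lemma pushE e t u l :
  push e t u l = (u l \mPo shear e t)
     - ((t *: 'X_k ^+ e.-1 *+ e) * (u k \mPo shear e t)) *+ (l == i).
Proof.
rewrite ffunE shearX raddfD comp_mpolyD /= vf_applyX; congr (_ + _).
rewrite raddfMn /= comp_mpolyMn linearZ /= comp_mpolyZ scaleNr -mulNrn.
congr (- _ *+ _).
rewrite /vf_apply (bigD1 k) //= big1 ?addr0 => [|j jk]; last first.
  by rewrite mderiv_XUexp eq_sym (negPf jk) mulr0.
rewrite mderiv_XUexp eqxx mulr1n rmorphM rmorphMn /= shearXk.
by rewrite mulrC scalerAl scalerMnr.
Qed.

(** The correction along the [i]-th axis in [push] cancels the extra term of the
    chain rule. All formal properties of [push] follow from this identity. *)
Lemma push_apply e t u p :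
  vf_apply (push e t u) (p \mPo shear e t) = vf_apply u p \mPo shear e t.
Proof.
rewrite /vf_apply raddf_sum /=.
have -> : \sum_(j < n) push e t u j * mderiv j (p \mPo shear e t)
  = \sum_(j < n) ((u j \mPo shear e t) * (mderiv j p \mPo shear e t)
    + (((t *: 'X_k ^+ e.-1 *+ e) * (u k \mPo shear e t)
         * (mderiv i p \mPo shear e t)) *+ (j == k)
    - ((t *: 'X_k ^+ e.-1 *+ e) * (u k \mPo shear e t)
         * (mderiv i p \mPo shear e t)) *+ (j == i))).
  apply: eq_bigr => j _; rewrite pushE mderiv_shear.
  case: (eqVneq j k) => [->|_]; rewrite ?mulr1n ?mulr0n.
    by rewrite eq_sym (negPf ik) !mulr0n !subr0; ring.
  by case: (eqVneq j i) => [->|_]; rewrite ?mulr1n ?mulr0n; ring.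
rewrite big_split /= sumrB !sumr_delta subrr addr0.
by apply: eq_bigr => j _; rewrite rmorphM.
Qed.

Lemma pushVK e t u : push e (- t) (push e t u) = u.
Proof. by apply/ffunP => l; rewrite ffunE opprK push_apply shearVK vf_applyX. Qed.

Lemma push_combo e t a u v : push e t (a *: u + v) = a *: push e t u + push e t v.
Proof.
by apply/ffunP => l; rewrite !ffunE vf_apply_combo comp_mpolyD comp_mpolyZ.
Qed.

Lemma push_bracket e t u v :
  push e t (vf_bracket u v) = vf_bracket (push e t u) (push e t v).
Proof.
apply/ffunP => l; rewrite vf_bracketE ffunE vf_bracket_comm comp_mpolyB.
by rewrite [push e t v l]ffunE [push e t u l]ffunE !push_apply.
Qed.

(** The Jacobian matrix of a shear is unipotent, so the divergence is only
    transported. *)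
Lemma push_div e t u : vf_div (push e t u) = vf_div u \mPo shear e t.
Proof.
rewrite /vf_div raddf_sum /=.
under eq_bigr => l _ do rewrite pushE mderivB mderiv_shear mderivMn mderivM.
rewrite sumrB big_split /= !sumr_delta.
rewrite mderivMn mderivZ mderiv_XUexp eq_sym (negPf ik) mulr0n scaler0 mul0rn.
by rewrite mul0r add0r mderiv_shear (negPf ik) addr0 addrK.
Qed.

Lemma push_const_div e t u : const_div u -> const_div (push e t u).
Proof. by case=> c uc; exists c; rewrite push_div uc comp_mpolyC. Qed.

(** If [D] works for the transform of [u], its inverse transform works for [u]:
    [push] is an automorphism of Lie algebras that preserves constant divergence. *)
Lemma completable_push e t u : completable (push e t u) -> completable u.
Proof.
case=> D [cD genD]; exists (push e (- t) D); split; first exact: push_const_div.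
move=> w cw L [L0 LZ LB] Lgen.
rewrite -(pushVK e t w).
apply: (genD _ (push_const_div e t cw) (fun v => L (push e (- t) v))).
  split=> [|a v1 v2 L1 L2|v1 v2 L1 L2].
  - have -> : push e (- t) 0 = 0 :> vfield K n; last exact: L0.
    by apply/ffunP => l; rewrite pushE !ffunE !comp_mpoly0 mulr0 mul0rn subr0.
  - by rewrite push_combo; apply: LZ.
  - by rewrite push_bracket; apply: LB.
by move=> v [->|->]; apply: Lgen; [left; rewrite pushVK | right].
Qed.

(** A shear is the identity modulo ['X_k ^+ e], which is why it does not affect the
    coefficients of degree less than [e]. *)
Lemma shear_subr_dvd e t p : exists q, p \mPo shear e t = p + 'X_k ^+ e * q.
Proof.
elim/mpoly_ring_ind: p => [c|l|p q [p' IHp] [q' IHq]|p q [p' IHp] [q' IHq]].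
- by exists 0; rewrite comp_mpolyC mulr0 addr0.
- exists (t%:MP *+ (l == i)); rewrite shearX; congr (_ + _).
  by rewrite mulrnAr mulrC mul_mpolyC.
- by exists (p' + q'); rewrite comp_mpolyD IHp IHq; ring.
- exists (p' * q + p * q' + p' * 'X_k ^+ e * q').
  by rewrite rmorphM /= IHp IHq; ring.
Qed.

Lemma mcoeff_shear e t p m : (mdeg m < e)%N -> (p \mPo shear e t)@_m = p@_m.
Proof.
case: (shear_subr_dvd e t p) => q -> me.
rewrite mcoeffD mpolyXn mcoeff_XM_eq0 ?addr0 // => b bm.
by move: me; rewrite -bm mdegD mdegMn mdeg1 mul1n ltnNge leq_addr.
Qed.

(** To order [d], the shear by a form of degree [d + 1] only modifies one
    coefficient, by a multiple of the constant term of the [k]-th component. *)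
Lemma mcoeff_push d t u l m : (mdeg m <= d)%N ->
  (push d.+1 t u l)@_m
    = (u l)@_m - (t * (u k)@_0 *+ d.+1) *+ ((l == i) && (m == (U_(k) *+ d)%MM)).
Proof.
move=> md; rewrite pushE mcoeffB mcoeff_shear // mcoeffMn; congr (_ - _).
case: (l == i) => /=; last by rewrite !mulr0n.
rewrite mulr1n scalerMnl -scalerAl mcoeffZ mpolyXn.
case: eqP => [->|mk].
  have := mcoeffMX (u k \mPo shear d.+1 t) (U_(k) *+ d)%MM 0%MM.
  rewrite addm0 mulrC => ->.
  by rewrite mulr1n mcoeff_shear ?mdeg0 // mulrnAl.
rewrite mcoeff_XM_eq0 ?mulr0 // => b bm; case: mk.
have /eqP : mdeg b = 0%N.
  by move: md; rewrite -bm mdegD mdegMn mdeg1 mul1n; lia.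
by rewrite mdeg_eq0 => /eqP b0; rewrite -bm b0 addm0.
Qed.

Lemma meval_translation t p (a : 'I_n -> K) :
  (p \mPo shear 0 t).@[a] = p.@[fun l => a l + t *+ (l == i)].
Proof.
rewrite comp_mpoly_meval; apply: meval_eq => l.
by rewrite tnth_mktuple mevalD mevalXU mevalMn mevalZ expr0 meval1 mulr1.
Qed.

End Shear.

(** * A generic transform *)

Definition base_value (n N : nat) (m : 'X_{1..n}) : nat :=
  (\sum_(i < n) m i * N ^ i)%N.

Lemma digits_inj (N n : nat) (f g : 'I_n -> nat) :
    (forall i, f i < N)%N -> (forall i, g i < N)%N ->
    (\sum_(i < n) f i * N ^ i = \sum_(i < n) g i * N ^ i)%N ->
  f =1 g.
Proof.
elim: n f g => [|n IHn] f g fN gN; first by move=> _ [].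
rewrite !big_ord_recl /= expn0 !muln1.
have shift (h : 'I_n.+1 -> nat) :
    (\sum_(i < n) h (lift ord0 i) * N ^ bump 0 i
      = (\sum_(i < n) h (lift ord0 i) * N ^ i) * N)%N.
  by rewrite big_distrl; apply: eq_bigr => i _ /=; rewrite expnSr mulnA.
rewrite !shift => fg.
have N0 : (0 < N)%N by apply: leq_ltn_trans (fN ord0).
have fg0 : f ord0 = g ord0.
  by rewrite -[LHS](modn_small (fN ord0)) -[RHS](modn_small (gN ord0))
    -(modnMDl (\sum_(i < n) f (lift ord0 i) * N ^ i)) addnC fg addnC modnMDl.
move/eqP: fg; rewrite fg0 eqn_add2l eqn_pmul2r // => /eqP fgS i.
case: (unliftP ord0 i) => [j ->|-> //].
by apply: (IHn (f \o lift ord0) (g \o lift ord0)) => // j'; rewrite /= ?fN ?gN.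
Qed.

Section CharacteristicZero.
Variables (K : fieldType) (charK : [pchar K] =i pred0).

Lemma natr_neq0 j : (j.+1%:R : K) != 0.
Proof. by rewrite ((pcharf0P K).1 charK). Qed.

Lemma natr_inj : injective (fun j => j%:R : K).
Proof.
move=> j1 j2; wlog le12 : j1 j2 / (j1 <= j2)%N.
  by move=> W; case: (leqP j1 j2) => [/W // | /ltnW /W W' /esym /W'].
move/eqP; rewrite eq_sym -subr_eq0 -natrB // ((pcharf0P K).1 charK) subn_eq0 => le21.
by apply/eqP; rewrite eqn_leq le12.
Qed.

Lemma poly_nonroot (P : {poly K}) : P != 0 -> exists y, P.[y] != 0.
Proof.
move=> P0; pose rs : seq K := [seq j%:R | j <- iota 0 (size P)].
have : ~~ all (root P) rs.
  apply/negP => all_rs; have := max_poly_roots P0 all_rs.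
  rewrite map_inj_uniq ?iota_uniq; last exact: natr_inj.
  by rewrite size_map size_iota ltnn => /(_ isT).
by case/allPn => y _; exists y.
Qed.

(** By Kronecker's substitution [x_i := y ^ (N ^ i)], which separates the monomials of
    degree less than [N], one variable is enough. *)
Lemma mpoly_nonroot n (p : {mpoly K[n]}) : p != 0 -> exists a, p.@[a] != 0.
Proof.
move=> p0; pose N := msize p; pose wt := @base_value n N.
have ltN m i : m \in msupp p -> (m i < N)%N.
  move/msize_mdeg_lt; apply: leq_ltn_trans.
  by rewrite mdegE (bigD1 i) //= leq_addr.
pose P : {poly K} := \sum_(m <- msupp p) p@_m *: 'X^(wt m).
have [m0 m0p] : exists m, m \in msupp p by exists (mlead p); apply: mlead_supp.
have : P != 0.
  apply/eqP => /(congr1 (fun q : {poly K} => q`_(wt m0))); rewrite coef0.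
  rewrite coef_sum (bigD1_seq m0) ?msupp_uniq //= coefZ coefXn eqxx mulr1.
  rewrite big_seq_cond big1 ?addr0 => [|m /andP[mp mm0]].
    by apply/eqP; rewrite -mcoeff_msupp.
  rewrite coefZ coefXn; case: eqP => [wtm|_]; last by rewrite mulr0.
  case/eqP: mm0; apply/mnmP; apply: (@digits_inj N) => [i|i|//]; exact: ltN.
case/poly_nonroot => y Py; exists (fun i : 'I_n => y ^+ (N ^ i)).
rewrite mevalE; suff <- : P.[y]
  = \sum_(m <- msupp p) p@_m * \prod_(i < n) (y ^+ (N ^ i)) ^+ m i by [].
rewrite horner_sum; apply: eq_bigr => m _; rewrite hornerZ hornerXn; congr (_ * _).
rewrite /wt /base_value -prodrXr; apply: eq_bigr => i _.
by rewrite -exprM mulnC.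
Qed.

Lemma meval_at0 n (p : {mpoly K[n]}) (a : 'I_n -> K) :
  (forall i, a i = 0) -> p.@[a] = p@_0.
Proof.
move=> a0; rewrite mevalE [X in _ = X@__]mpolyE raddf_sum; apply: eq_bigr => m _.
rewrite /= mcoeffZ mcoeffX; congr (_ * _).
case: eqP => [->|m0]; first by rewrite big1 // => i _; rewrite mnm0E.
have [i mi] : exists i, m i != 0%N.
  apply/existsP; rewrite -negb_forall; apply/forallP => m_eq0; apply: m0.
  by apply/mnmP => i; rewrite mnm0E; apply/eqP.
by rewrite (bigD1 i) //= a0 expr0n (negPf mi) mul0r.
Qed.

Section Generic.
Variables (n : nat) (n_ge2 : (2 <= n)%N).
Implicit Types (u v : vfield K n).

Lemma other_index (i : 'I_n) : exists j : 'I_n, i != j.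
Proof.
apply/existsP; rewrite -[[exists _, _]]negbK negb_exists.
apply/forallP => all_i; have : (#|'I_n| <= 1)%N.
  apply: (@leq_trans #|[set i]|); last by rewrite cards1.
  by apply/subset_leq_card/subsetP => j _; have := all_i j; rewrite inE negbK eq_sym.
by rewrite card_ord leqNgt n_ge2.
Qed.

(** A point where the [k]-th component does not vanish is moved to the origin, one
    coordinate at a time. *)
Lemma completable_translate k u :
    (forall v, (v k)@_0 != 0 -> completable v) -> u k != 0 ->
  completable u.
Proof.
move=> W /mpoly_nonroot[a].
have : forall i, i \notin enum 'I_n -> a i = 0 by move=> i; rewrite mem_enum.
elim: (enum 'I_n) u a => [|i s IHs] u a a0 ua.
  by apply: W; rewrite -(meval_at0 _ (a := a)) // => i; apply: a0.
have [j ij] := other_index i; apply: (@completable_push _ _ i j ij 0 (a i)).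
apply: (IHs _ (fun l => if l == i then 0 else a l)) => [l ls|].
  by case: eqP => // /eqP li; apply: a0; rewrite inE negb_or li.
rewrite pushE // mulr0n mul0r mul0rn subr0 meval_translation.
rewrite (meval_eq _ (v2 := a)) // => l.
by case: eqP => [->|_]; rewrite ?add0r ?addr0.
Qed.

(** The shear is applied only when the targeted coefficient vanishes, so the change
    that it makes cannot cancel it; any nonzero [t] then works. *)
Lemma completable_adjust d i k u : i != k -> (u k)@_0 != 0 ->
    (forall v, (v i)@_(U_(k) *+ d) != 0 ->
       (forall l m, (mdeg m <= d)%N -> (l, m) != (i, (U_(k) *+ d)%MM) ->
          (v l)@_m = (u l)@_m) ->
       completable v) ->
  completable u.
Proof.
move=> ik uk W; have [uik|uik] := eqVneq (u i)@_(U_(k) *+ d) 0; last exact: W.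
apply: (@completable_push _ _ i k ik d.+1 1); apply: W => [|l m md].
  rewrite mcoeff_push ?mdegMn ?mdeg1 ?mul1n // !eqxx uik sub0r oppr_eq0 mulr1n.
  by rewrite mul1r -mulr_natr mulf_neq0 ?natr_neq0.
by rewrite mcoeff_push // -pair_eqE /= => /negPf ->; rewrite subr0.
Qed.

Definition generic_jet u : Prop :=
  (forall i, (u i)@_0 != 0) /\ (forall i k, i != k -> (u i)@_(U_(k) *+ 2) != 0).

(** Adjustments do not spoil one another: those with [d = 0] all use the fixed index
    [k] and do not touch the [k]-th constant coefficient, and those with [d = 2] act on
    distinct coefficients of degree 2. *)
Lemma completable_generic u :
  (forall v, generic_jet v -> completable v) -> u <> 0 -> completable u.
Proof.
move=> W u0.
have [k uk] : exists k, u k != 0.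
  apply/existsP; rewrite -[[exists _, _]]negbK negb_exists.
  apply/negP => /forallP all0; apply: u0; apply/ffunP => l.
  by rewrite ffunE; apply/eqP; rewrite -[_ == _]negbK.
apply: completable_translate uk => {u0} {}u uk.
(* The list [s] holds the coefficients that may still vanish. *)
have const_step v : (forall i, (v i)@_0 != 0) -> completable v.
  have : forall i k, i != k -> (i, k) \notin enum {: 'I_n * 'I_n} ->
      (v i)@_(U_(k) *+ 2) != 0 by move=> i j _; rewrite mem_enum.
  elim: (enum _) v => [|[i j] s IHs] v vs v0; first by apply: W; split=> // *; apply: vs.
  have [ij|ij] := eqVneq i j.
    by apply: IHs v0 => i' j' ij' ns; apply: vs; rewrite // inE negb_or ns andbT
      -pair_eqE /= ij; apply: contraNN ij' => /andP[/eqP-> /eqP->].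
  apply: (completable_adjust (d := 2) ij (v0 j)) => w wij wv.
  apply: IHs => [i' j' ij' ns|l].
    have [e|ne] := eqVneq (i', j') (i, j); first by case: e => -> ->.
    rewrite wv ?mdegMn ?mdeg1 ?vs ?inE ?negb_or ?ne // -pair_eqE /=.
    apply: contraNN ne => /andP[/eqP-> /eqP /mnmP /(_ j')].
    by rewrite !mulmnE !mnm1E eqxx -pair_eqE /= eqxx eq_sym; case: eqP.
  rewrite wv ?mdeg0 // -pair_eqE /= negb_and; apply/orP; right.
  apply/eqP => /mnmP /(_ j); by rewrite mulmnE mnm1E eqxx mnm0E.
have : forall i, i \notin enum 'I_n -> (u i)@_0 != 0 by move=> i; rewrite mem_enum.
elim: (enum _) u uk => [|i s IHs] u uk us; first by apply: const_step => i; apply: us.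
have [ik|ik] := eqVneq i k.
  apply: IHs => // l ls; have [->//|lk] := eqVneq l k.
  by apply: us; rewrite inE negb_or ls ik lk.
apply: (completable_adjust (d := 0) ik uk); rewrite mulm0n => v vi vu.
have vE l : l != i -> (v l)@_0 = (u l)@_0.
  by move=> li; rewrite vu ?mdeg0 // -pair_eqE /= negb_and li.
apply: IHs => [|l ls]; first by rewrite vE // eq_sym.
by have [->//|li] := eqVneq l i; rewrite vE // us // inE negb_or li.
Qed.

End Generic.
End CharacteristicZero.

(** * Weight components under a diagonal field *)

Section Subalgebra.
Variables (K : fieldType) (n : nat) (L : vfield K n -> Prop).
Hypothesis lieL : lie_subalgebra L.
Implicit Types (u v : vfield K n) (p q : {mpoly K[n]}).

Definition fld i p : vfield K n := [ffun l => p *+ (l == i)].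

Lemma lie_sub0 : L 0. Proof. by case: lieL. Qed.

Lemma lie_subZD a u v : L u -> L v -> L (a *: u + v).
Proof. by case: lieL => _ LZ _; apply: LZ. Qed.

Lemma lie_subZ a u : L u -> L (a *: u).
Proof. by move=> Lu; rewrite -[a *: u]addr0; apply: lie_subZD lie_sub0. Qed.

Lemma lie_subZr a u : a != 0 -> L (a *: u) -> L u.
Proof. by move=> a0 /(lie_subZ a^-1); rewrite scalerA mulVf ?scale1r. Qed.

Lemma lie_subD u v : L u -> L v -> L (u + v).
Proof. by rewrite -{2}[u]scale1r; apply: lie_subZD. Qed.

Lemma lie_subB u v : L u -> L v -> L (u - v).
Proof. by rewrite addrC -scaleN1r => Lu Lv; apply: lie_subZD. Qed.

Lemma lie_sub_bracket u v : L u -> L v -> L (vf_bracket u v).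
Proof. by case: lieL => _ _; apply. Qed.

Lemma lie_sub_sum (I : eqType) (r : seq I) (F : I -> vfield K n) :
  (forall x, x \in r -> L (F x)) -> L (\sum_(x <- r) F x).
Proof.
move=> LF; rewrite big_seq; apply: big_ind => //; first exact: lie_sub0.
exact: lie_subD.
Qed.

(** If [ad T] is diagonal on monomial fields, a polynomial in [ad T] that vanishes
    at every other weight of [u] isolates a monomial whose weight is not shared. *)
Lemma lie_sub_component (T u : vfield K n) (w : 'I_n -> 'X_{1..n} -> K) i m0 :
    L T -> L u ->
    (forall v l m, (vf_bracket T v l)@_m = w l m * (v l)@_m) ->
    (u i)@_m0 != 0 ->
    (forall l m, m \in msupp (u l) -> w l m = w i m0 -> (l, m) = (i, m0)) ->
  L (fld i 'X_[m0]).
Proof.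
move=> LT Lu wT um0 w_sep.
have spectral (W : seq K) : exists v, L v /\
    forall l m, (v l)@_m = (\prod_(x <- W) (w l m - x)) * (u l)@_m.
  elim: W => [|x W [v [Lv vE]]].
    by exists u; split=> // l m; rewrite big_nil mul1r.
  exists (- x *: v + vf_bracket T v); split.
    by apply: lie_subZD => //; apply: lie_sub_bracket.
  move=> l m; rewrite big_cons !ffunE mcoeffD mcoeffZ.
  have := wT v l m; rewrite ffunE => ->; rewrite vE; ring.
(* All the weights of [u] except the one to isolate. *)
pose W := [seq x <- flatten [seq [seq w l m | m <- msupp (u l)] | l <- enum 'I_n]
          | x != w i m0].
have [v [Lv vE]] := spectral W; pose c := (v i)@_m0.
have c0 : c != 0.
  rewrite /c vE mulf_neq0 // prodf_seq_neq0; apply/allP => x.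
  by rewrite mem_filter subr_eq0 eq_sym => /andP[].
apply: (lie_subZr c0); suff <- : v = c *: fld i 'X_[m0] by [].
apply/ffunP => l; apply/mpolyP => m; rewrite !ffunE mcoeffZ mcoeffMn mcoeffX.
have [[-> ->]|lm] := eqVneq (l, m) (i, m0); first by rewrite !eqxx mulr1.
rewrite -mulrnA [(m0 == m)]eq_sym mulnb andbC -[X in nat_of_bool X]/((l, m) == (i, m0)).
rewrite (negPf lm) mulr0 vE; have [ml|] := boolP (m \in msupp (u l)); last first.
  by move/memN_msupp_eq0 ->; rewrite mulr0.
suff /eqP -> : \prod_(x <- W) (w l m - x) == 0 by rewrite mul0r.
rewrite prodf_seq_eq0; apply/hasP; exists (w l m); last by rewrite /= subrr eqxx.
rewrite mem_filter; apply/andP; split; last first.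
  apply/flattenP; exists [seq w l m | m <- msupp (u l)]; last exact: map_f.
  by apply/mapP; exists l; rewrite ?mem_enum.
by apply: contraNneq lm => /(w_sep _ _ ml) ->.
Qed.

End Subalgebra.

Section Torus.
Variables (K : fieldType) (charK : [pchar K] =i pred0) (n : nat).
Implicit Types (u v : vfield K n) (p q : {mpoly K[n]}) (N : nat).

(** Rational weights always satisfy linear relations; powers of a large [N] only
    satisfy relations whose coefficients are too large to matter in low degree. *)
Definition torus N : vfield K n := [ffun i : 'I_n => (N ^ i)%N%:R *: 'X_i].

Lemma mcoeff_euler i p m : ('X_i * mderiv i p)@_m = p@_m *+ m i.
Proof.
case mi: (m i) => [|e].
  by rewrite mcoeff_XM_eq0 // => b /mnmP/(_ i); rewrite mnmDE mnm1E eqxx mi.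
have mE : m = (U_(i) + (m - U_(i)))%MM.
  apply/mnmP => l; rewrite mnmDE mnmBE mnm1E.
  case: eqP => [<-|_]; last by rewrite add0n subn0.
  by rewrite mi subn1 add1n.
rewrite {1}mE mulrC mcoeffMX mcoeff_deriv addmC -mE mnmBE mnm1E eqxx mi.
by rewrite subn1.
Qed.

Lemma torus_bracket N u l m :
  (vf_bracket (torus N) u l)@_m
    = ((base_value N m)%:R - (N ^ l)%N%:R) * (u l)@_m.
Proof.
rewrite vf_bracketE ffunE linearZ /= vf_applyX mcoeffB mcoeffZ mulrBl; congr (_ - _).
rewrite raddf_sum natr_sum mulr_suml; apply: eq_bigr => i _.
rewrite /= ffunE -scalerAl mcoeffZ mcoeff_euler natrM -mulr_natr; ring.
Qed.

Lemma torus_div N : vf_div (torus N) = (\sum_(i < n) N ^ i)%N%:R%:MP.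
Proof.
rewrite natr_sum raddf_sum; apply: eq_bigr => i _ /=.
by rewrite ffunE mderivZ mderivXU eqxx -mul_mpolyC mulr1.
Qed.

Lemma mul_X_mderivX (i : 'I_n) m :
  'X_i * mderiv i 'X_[m] = (m i)%:R *: 'X_[m] :> {mpoly K[n]}.
Proof.
apply/mpolyP => m'; rewrite mcoeff_euler mcoeffZ mcoeffX mulr_natl.
by case: eqP => [->//|_]; rewrite !mul0rn.
Qed.

Lemma base_valueDU N (m : 'X_{1..n}) i :
  base_value N (m + U_(i)) = (base_value N m + N ^ i)%N.
Proof.
rewrite /base_value; under eq_bigr => j _ do rewrite mnmDE mnm1E mulnDl.
rewrite big_split /=; congr (_ + _)%N.
rewrite (bigD1 i) //= eqxx mul1n big1 ?addn0 // => j ji.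
by rewrite eq_sym (negPf ji).
Qed.

(** Since [m0 i = 0], the multidegree [m0 - e_i] of [x^m0 d_i] has a negative entry,
    which only [d_i] can produce. In low degree the weight determines the
    multidegree, after [N ^ i] and [N ^ l] are moved to make both sides numbers in
    base [N]. *)
Lemma torus_separates u i (m0 : 'X_{1..n}) N :
    m0 i = 0%N -> ((mdeg m0).+1 < N)%N -> (forall l, (msize (u l) < N)%N) ->
  forall l m, m \in msupp (u l) ->
    (base_value N m)%:R - (N ^ l)%N%:R = (base_value N m0)%:R - (N ^ i)%N%:R :> K ->
  (l, m) = (i, m0).
Proof.
move=> m0i m0N uN l m mu /eqP; rewrite subr_eq addrAC eq_sym subr_eq -!natrD.
rewrite -!base_valueDU => /eqP/(natr_inj charK) eqv.
have mdN : ((mdeg m).+1 < N)%N by apply: leq_ltn_trans (uN l); apply: msize_mdeg_lt.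
have digitN (m1 : 'X_{1..n}) i1 j : ((mdeg m1).+1 < N)%N -> ((m1 + U_(i1))%MM j < N)%N.
  apply: leq_ltn_trans; rewrite mnmDE mnm1E -addn1 leq_add ?leq_b1 //.
  by rewrite mdegE (bigD1 j) //= leq_addr.
have eqm := digits_inj (fun j => digitN m0 l j m0N) (fun j => digitN m i j mdN) eqv.
have li : l = i.
  have := eqm i; rewrite !mnmDE !mnm1E m0i eqxx.
  by case: eqP => // _; rewrite addn1.
by move/mnmP: eqm; rewrite li => /addIm ->.
Qed.

End Torus.

(** * Generation by constant and quadratic shears *)

Section Generation.
Variables (K : fieldType) (charK : [pchar K] =i pred0) (n : nat).
Variables (L : vfield K n -> Prop) (lieL : lie_subalgebra L) (o : 'I_n).
Implicit Types (f g : {mpoly K[n]}).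

Hypothesis L_const : forall i, L (fld i 1).
Hypothesis L_quad : forall i k, i != k -> L (fld i ('X_k ^+ 2)).

Definition pois j f g := mderiv o f * mderiv j g - mderiv j f * mderiv o g.
Definition ham j f : vfield K n := fld j (mderiv o f) - fld o (mderiv j f).

Lemma fld_apply i f g : vf_apply (fld i f) g = f * mderiv i g.
Proof.
rewrite /vf_apply -[RHS](sumr_delta i (fun l => f * mderiv l g)).
by apply: eq_bigr => l _; rewrite ffunE mulrnAl.
Qed.

Lemma vf_applyB (u v : vfield K n) g : vf_apply (u - v) g = vf_apply u g - vf_apply v g.
Proof. by rewrite addrC -scaleN1r vf_apply_combo scaleN1r addrC. Qed.

Lemma ham_apply j f g : vf_apply (ham j f) g = pois j f g.
Proof. by rewrite vf_applyB !fld_apply. Qed.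

Lemma ham_bracket j f g : vf_bracket (ham j f) (ham j g) = ham j (pois j f g).
Proof.
apply: vf_apply_inj => h; rewrite vf_bracket_comm !ham_apply /pois.
rewrite !(mderivB, mderivM) ![mderiv o (mderiv j _)]mderiv_comm; ring.
Qed.

Lemma fldZD i a f g : fld i (a *: f + g) = a *: fld i f + fld i g.
Proof. by apply/ffunP => l; rewrite !ffunE mulrnDl scalerMnr. Qed.

Lemma fld0 i : fld i 0 = 0 :> vfield K n.
Proof. by apply/ffunP => l; rewrite !ffunE mul0rn. Qed.

Lemma fldZ i a f : fld i (a *: f) = a *: fld i f.
Proof. by rewrite -[a *: f]addr0 fldZD fld0 addr0. Qed.

Lemma fld_nat i f e : fld i (f *+ e) = e%:R *: fld i f.
Proof. by rewrite -scaler_nat fldZ. Qed.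

Lemma hamZD j a f g : ham j (a *: f + g) = a *: ham j f + ham j g.
Proof.
rewrite /ham !mderivD !mderivZ !fldZD scalerBr -!scaleN1r !scalerDr; apply/ffunP=> l.
by rewrite !ffunE addrACA.
Qed.

Lemma ham0 j : ham j 0 = 0.
Proof. by rewrite /ham !mderiv0 !fld0 subr0. Qed.

Lemma hamZ j a f : ham j (a *: f) = a *: ham j f.
Proof. by rewrite -[a *: f]addr0 hamZD ham0 addr0. Qed.

Section OnePlane.
Variables (j : 'I_n) (oj : o != j).
Local Notation x := ('X_o : {mpoly K[n]}).
Local Notation y := ('X_j : {mpoly K[n]}).
Let S f := L (ham j f).

Let S_pois f g : S f -> S g -> S (pois j f g).
Proof. by rewrite /S -ham_bracket; apply: lie_sub_bracket. Qed.

Let S_nat e f : S (f *+ e.+1) -> S f.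
Proof.
rewrite /S -scaler_nat hamZ; apply: (lie_subZr lieL); exact: natr_neq0.
Qed.

Let S_opp f : S (- f) -> S f.
Proof.
rewrite /S -scaleN1r hamZ; apply: (lie_subZr lieL).
by rewrite oppr_eq0 oner_eq0.
Qed.

Let jo : j == o = false. Proof. by rewrite eq_sym; apply: negPf. Qed.
Let derE := (mderivM, mderiv_XUexp, mderivXU, eqxx, jo, negPf oj, mulr1n, mulr0n).

Let S_x : S x.
Proof. by rewrite /S /ham !derE fld0 subr0; apply: L_const. Qed.

Let S_y : S y.
Proof.
by rewrite /S /ham !derE fld0; apply: (lie_subB lieL); [apply: lie_sub0 | apply: L_const].
Qed.

Let S_x3 : S (x ^+ 3).
Proof.
rewrite /S /ham !derE fld0 subr0 fld_nat; apply: (lie_subZ lieL).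
by apply: L_quad; rewrite eq_sym.
Qed.

Let S_y3 : S (y ^+ 3).
Proof.
rewrite /S /ham !derE fld0 fld_nat; apply: (lie_subB lieL); first exact: lie_sub0.
by apply: (lie_subZ lieL); apply: L_quad.
Qed.

Let S_x2y2 : S (x ^+ 2 * y ^+ 2).
Proof.
apply: (@S_nat 8).
rewrite (_ : _ *+ 9 = pois j (x ^+ 3) (y ^+ 3)); first exact: S_pois.
rewrite /pois !derE /=; ring.
Qed.

Let S_x2y : S (x ^+ 2 * y).
Proof.
apply/(@S_nat 1)/S_opp.
rewrite (_ : - _ = pois j (x ^+ 2 * y ^+ 2) x); first exact: S_pois.
rewrite /pois !derE /=; ring.
Qed.

Lemma lie_sub_ham_xy2 : L (ham j (x * y ^+ 2)).
Proof.
apply: (@S_nat 1).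
rewrite (_ : _ *+ _ = pois j (x ^+ 2 * y ^+ 2) y); first exact: S_pois.
rewrite /pois !derE /=; ring.
Qed.

Let S_xexp e : S (x ^+ e.+1).
Proof.
elim: e => [|e IHe]; first by rewrite expr1.
apply/(@S_nat e)/S_opp.
rewrite (_ : - _ = pois j (x ^+ 2 * y) (x ^+ e.+1)); first exact: S_pois.
by rewrite /pois !derE /= mulr0 sub0r mul0r add0r mulr1 mulrnAr -exprD.
Qed.

(** For [q] a monomial free of [x], the bracket of [x ^ a.+1] and [q y] is a multiple of
    [x ^ a q], and the field of [q y] is a multiple of the shear [q d_o]. *)
Lemma lie_sub_ham (f : {mpoly K[n]}) :
  (forall m : 'X_{1..n}, m o = 0%N -> L (fld o 'X_[m])) -> L (ham j f).
Proof.
move=> L_shear; elim/mpolyind: f => [|c m p _ _ IHp].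
  by rewrite ham0; apply: lie_sub0.
rewrite hamZD; apply: (lie_subZD lieL) => //.
pose m' := (m - U_(o) *+ m o)%MM.
have m'o : m' o = 0%N by rewrite mnmBE mulmnE mnm1E eqxx mul1n subnn.
have mE : 'X_[m] = x ^+ m o * 'X_[m'] :> {mpoly K[n]}.
  rewrite mpolyXn -mpolyXD; congr 'X_[_]; apply/mnmP => l.
  rewrite mnmDE mnmBE mulmnE mnm1E; case: eqP => [<-|_]; last by rewrite subn0.
  by rewrite mul1n subnn addn0.
have d_o : mderiv o 'X_[m'] = 0 :> {mpoly K[n]} by rewrite mderivX m'o scale0r.
have d_j : mderiv j ('X_[m'] * y) = 'X_[m'] *+ (m' j).+1.
  by rewrite mderivM mulrC mul_X_mderivX mderivXU eqxx mulr1 scaler_nat -mulrSr.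
have S_m'y : S ('X_[m'] * y).
  rewrite /S /ham d_j mderivM d_o mderivXU jo mul0r mulr0 addr0 fld0 fld_nat.
  by apply: (lie_subB lieL); [apply: lie_sub0 | apply: (lie_subZ lieL); apply: L_shear].
rewrite mE; apply/(@S_nat (m o))/(@S_nat (m' j)).
rewrite (_ : _ *+ _ = pois j (x ^+ (m o).+1) ('X_[m'] * y)); first exact: S_pois.
rewrite /pois d_j !derE /= mul0r subr0; ring.
Qed.

End OnePlane.

(** The bracket of [q d_o] with the field of [x_o x_j ^ 2] is
    [- (2 + e) x_j q d_o], where [e] is the degree of [q] in [x_j]; the factor is nonzero
    in characteristic zero, so any monomial can be built up from [q = 1]. *)
Lemma lie_sub_shear (m : 'X_{1..n}) : m o = 0%N -> L (fld o 'X_[m]).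
Proof.
elim: {m}(mdeg m) {-2}m (erefl (mdeg m)) => [|d IHd] m md mo.
  by move/eqP: md; rewrite mdeg_eq0 => /eqP ->; rewrite mpolyX0; apply: L_const.
have [j mj] : exists j, m j != 0%N.
  apply/existsP; rewrite -negb_forall; apply/forallP => m_eq0.
  by move: md; rewrite mdegE big1 // => j _; apply/eqP.
have oj : o != j by apply: contraNneq mj => <-; rewrite mo.
pose m' := (m - U_(j))%MM.
have mE : m = (m' + U_(j))%MM.
  rewrite submK //; apply/mnm_lepP => l; rewrite mnm1E.
  by case: eqP => // <-; rewrite lt0n.
have m'o : m' o = 0%N by rewrite mnmBE mo.
have Lm' : L (fld o 'X_[m']).
  by apply: IHd => //; move: md; rewrite mE mdegD mdeg1 addn1 => -[].
apply: (lie_subZr lieL (natr_neq0 charK (m' j).+1)).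
apply: (lie_subZr lieL (a := -1)); first by rewrite oppr_eq0 oner_eq0.
rewrite (_ : _ *: _ = vf_bracket (fld o 'X_[m']) (ham j ('X_o * 'X_j ^+ 2))); last first.
  apply: vf_apply_inj => h; rewrite vf_bracket_comm !fld_apply !ham_apply /pois.
  have jo : j == o = false by rewrite eq_sym; apply: negPf.
  have q_o : mderiv o 'X_[m'] = 0 :> {mpoly K[n]} by rewrite mderivX m'o scale0r.
  have f_o : mderiv o ('X_o * 'X_j ^+ 2) = 'X_j ^+ 2 :> {mpoly K[n]}.
    by rewrite mderivM mderivXU mderiv_XUexp eqxx jo mul1r mulr0 addr0.
  have f_j : mderiv j ('X_o * 'X_j ^+ 2) = ('X_o * 'X_j) *+ 2 :> {mpoly K[n]}.
    by rewrite mderivM mderivXU mderiv_XUexp eqxx (negPf oj) mul0r add0r mulr1n mulrnAr.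
  have f_oo : mderiv o ('X_j ^+ 2) = 0 :> {mpoly K[n]} by rewrite mderiv_XUexp jo.
  have f_jo : mderiv o (('X_o * 'X_j) *+ 2) = 'X_j *+ 2 :> {mpoly K[n]}.
    by rewrite mderivMn mderivM !mderivXU eqxx jo mul1r mulr0 addr0.
  have q_j : ('X_[m'] * 'X_j) *+ (m' j).+2
      = 'X_j * ('X_j * mderiv j 'X_[m']) + ('X_[m'] * 'X_j) *+ 2 :> {mpoly K[n]}.
    by rewrite mul_X_mderivX scaler_nat -[(m' j).+2]addn2 mulrnDr mulrnAr ['X_j * _]mulrC.
  rewrite -fld_nat -fldZ fld_apply scaleN1r mE mpolyXD q_j.
  rewrite f_o f_j !(f_oo, f_jo, q_o, mderivB, mderivM).
  rewrite [mderiv o (mderiv j _)]mderiv_comm; ring.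
by apply: (lie_sub_bracket lieL) => //; apply: lie_sub_ham_xy2.
Qed.

Lemma antiderivative f : exists F, mderiv o F = f.
Proof.
elim/mpolyind: f => [|c m p _ _ [P <-]]; first by exists 0; rewrite mderiv0.
exists ((c / (m o).+1%:R) *: 'X_[m + U_(o)] + P).
rewrite mderivD mderivZ mderivX mnmDE mnm1E eqxx addn1 scalerA divfK ?natr_neq0 //.
by rewrite addmK.
Qed.

(** If [F j] integrates [u j] along [x_o], then [ham j (F j)] has the [j]-th component of
    [u]. Subtracting these fields for [j != o] leaves some [g d_o] with
    [d_o g = vf_div u = 0], a combination of shears. *)
Lemma lie_sub_div_free (u : vfield K n) : vf_div u = 0 -> L u.
Proof.
move=> u0; have [F FE] := fin_all_exists (fun j => antiderivative (u j)).
pose g := u o + \sum_(j < n | j != o) mderiv j (F j).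
have g0 : mderiv o g = 0.
  rewrite mderivD raddf_sum -[RHS]u0 /vf_div [RHS](bigD1 o) //=; congr (_ + _).
  by apply: eq_bigr => j _; rewrite mderiv_comm FE.
have -> : u = \sum_(j < n | j != o) ham j (F j) + fld o g.
  apply/ffunP => l; rewrite ffunE sum_ffunE.
  under eq_bigr => j _ do rewrite !ffunE FE.
  rewrite ffunE sumrB; have [->|lo] := eqVneq l o.
    rewrite mulr1n big1 => [|j jo]; last by rewrite eq_sym (negPf jo).
    under eq_bigr => j _ do rewrite mulr1n.
    by rewrite sub0r addrC addrK.
  rewrite mulr0n addr0 [X in _ - X]big1 ?subr0 => [|j _]; last by rewrite mulr0n.
  rewrite (bigD1 l) //= eqxx mulr1n big1 ?addr0 // => j /andP[_ jl].
  by rewrite eq_sym (negPf jl).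
apply: (lie_subD lieL).
  rewrite -big_filter; apply: lie_sub_sum => // j; rewrite mem_filter => /andP[jo _].
  by apply: lie_sub_ham; [rewrite eq_sym | apply: lie_sub_shear].
have -> : fld o g = \sum_(m <- msupp g) g@_m *: fld o 'X_[m].
  rewrite [in LHS](mpolyE g); elim: (msupp g) => [|m s IHs].
    by rewrite !big_nil fld0.
  by rewrite !big_cons fldZD IHs.
apply: lie_sub_sum => // m mg; apply: (lie_subZ lieL); apply: lie_sub_shear.
have := mcoeff_euler o g m; rewrite g0 mulr0 mcoeff0 -mulr_natr => /esym/eqP.
rewrite mulf_eq0 -[_ == 0]negbK -mcoeff_msupp mg /=.
by rewrite ((pcharf0P K).1 charK) => /eqP.
Qed.

Lemma vf_divZD (u v : vfield K n) a : vf_div (a *: u + v) = a *: vf_div u + vf_div v.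
Proof.
rewrite /vf_div scaler_sumr -big_split; apply: eq_bigr => i _.
by rewrite !ffunE mderivD mderivZ.
Qed.

Lemma lie_sub_const_div (T u : vfield K n) (c : K) :
  L T -> vf_div T = c%:MP -> c != 0 -> const_div u -> L u.
Proof.
move=> LT Tc c0 [b ub]; have -> : u = (b / c) *: T + (- (b / c) *: T + u).
  by rewrite scaleNr addNKr.
apply: (lie_subZD lieL) => //; apply: lie_sub_div_free.
by rewrite vf_divZD Tc ub -mul_mpolyC -mpolyCM mulNr divfK // mpolyCN addNr.
Qed.

End Generation.

Lemma completable_generic_jet (K : fieldType) (charK : [pchar K] =i pred0) (n : nat)
    (n_gt0 : (0 < n)%N) (u : vfield K n) : generic_jet u -> completable u.
Proof.
move=> [u0 u2]; pose N := (\max_(l < n) msize (u l) + 4)%N.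
have uN l : (msize (u l) < N)%N.
  apply: (@leq_ltn_trans (\max_(l' < n) msize (u l'))); first exact: leq_bigmax.
  by rewrite /N; lia.
have N4 : (3 < N)%N by rewrite /N leq_addl.
have div_neq0 : (\sum_(i < n) N ^ i)%N%:R != 0 :> K.
  rewrite ((pcharf0P K).1 charK) -lt0n (bigD1 (Ordinal n_gt0)) //=.
exists (torus K n N); split; first by eexists; apply: torus_div.
move=> w cw L lieL Lgen.
have LT : L (torus K n N) by apply: Lgen; right.
have Lu : L u by apply: Lgen; left.
have Lmon i (m : 'X_{1..n}) :
    m i = 0%N -> (mdeg m <= 2)%N -> (u i)@_m != 0 -> L (fld i 'X_[m]).
  move=> mi md um; apply: (lie_sub_component lieL LT Lu (torus_bracket N) um).
  by apply: torus_separates => //; apply: leq_ltn_trans N4.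
have Tdiv := torus_div K n N.
apply: (lie_sub_const_div charK lieL (Ordinal n_gt0) _ _ LT Tdiv div_neq0 cw).
- by move=> i; rewrite -mpolyX0; apply: Lmon; rewrite ?mnm0E ?mdeg0.
- move=> i k ik; rewrite mpolyXn; apply: Lmon; rewrite ?mdegMn ?mdeg1 ?u2 //.
  by rewrite mulmnE mnm1E eq_sym (negPf ik).
Qed.

Theorem theorem1 (K : fieldType) (charK : [pchar K] =i pred0)
    (n : nat) (n_ge2 : (2 <= n)%N) (delta : vfield K n) (delta_neq0 : delta <> 0) :
  exists D : vfield K n, const_div D /\
    (forall u : vfield K n, const_div u ->
       lie_generated (fun v => v = delta \/ v = D) u).
Proof.
apply: (completable_generic charK n_ge2 _ delta_neq0) => v.
by apply: completable_generic_jet => //; apply: ltnW.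
Qed.
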